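(* Let $H = (H,\mu_H,\Delta_H)$ be a bialgebra, $A = (A,\mu_A)$ be an associative algebra, and $\rho \colon H \otimes A \to A$ be an $H$-module-algebra structure on $A$ (all over $\mathbf{k}$). Suppose $\alpha_H \colon H \to H$ is a bialgebra morphism and $\alpha_A \colon A \to A$ is an algebra morphism such that \[ \alpha_A \circ \rho = \rho \circ (\alpha_H \otimes \alpha_A). \] For any integers $n, k \geq 0$, define the map \[ \rho_\alpha^{n,k} = \alpha_A^{2^k} \circ \rho \circ (\alpha_H^n \otimes Id_A) \colon H \otimes A \to A. \] Then each $\rho_\alpha^{n,k}$ gives $A_\beta$ the structure of an $H_\gamma$-module Hom-algebra, where $\beta = \alpha_A^{2^k}$, $\gamma = \alpha_H^{2^k}$, $A_\beta$ is the Hom-associative algebra $(A,\ \mu_\beta = \beta \circ \mu_A,\ \beta)$, and $H_\gamma$ is the Hom-bialgebra $(H,\ \mu_\gamma = \gamma \circ \mu_H,\ \Delta_\gamma = \Delta_H \circ \gamma,\ \gamma)$.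
   Context: $\mathbf{k}$ is a fixed associative and commutative ring of characteristic $0$; modules, tensor products and linear maps are over $\mathbf{k}$. For a self-map $\alpha$, $\alpha^n$ is the $n$-fold composition, $\alpha^0 = Id$. $\tau(v\otimes w)=w\otimes v$ is the twist isomorphism. $\Delta(x)=\sum_{(x)} x_1\otimes x_2$ is Sweedler's notation. For a bialgebra $H$ and an associative algebra $A$, an $H$-module-algebra structure on $A$ is an $H$-module structure (in the usual sense) $\rho\colon H\otimes A\to A$, $\rho(x,a)=xa$, such that $x(ab)=\sum_{(x)}(x_1a)(x_2b)$ for all $x\in H$, $a,b\in A$. A Hom-associative algebra $(A,\mu,\alpha)$ is a $\mathbf{k}$-module $A$ with linear maps $\mu\colon A^{\otimes 2}\to A$, $\alpha\colon A\to A$ such that $\alpha\circ\mu=\mu\circ\alpha^{\otimes 2}$ and $\mu\circ(\alpha\otimes\mu)=\mu\circ(\mu\otimes\alpha)$. A Hom-coassociative coalgebra $(C,\Delta,\alpha)$ is a $\mathbf{k}$-module $C$ with linear maps $\Delta\colon C\to C^{\otimes 2}$, $\alpha\colon C\to C$ such that $\alpha^{\otimes 2}\circ\Delta=\Delta\circ\alpha$ and $(\alpha\otimes\Delta)\circ\Delta=(\Delta\otimes\alpha)\circ\Delta$. A Hom-bialgebra $(H,\mu,\Delta,\alpha)$ is such that $(H,\mu,\alpha)$ is a Hom-associative algebra, $(H,\Delta,\alpha)$ is a Hom-coassociative coalgebra, and $\Delta\circ\mu=\mu^{\otimes 2}\circ(Id\otimes\tau\otimes Id)\circ\Delta^{\otimes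 2}$. A bialgebra $(H,\mu_H,\Delta_H)$ is the case $\alpha=Id$; bialgebra morphisms are linear maps commuting with the multiplications and the comultiplications. For a Hom-bialgebra $(H,\mu_H,\Delta_H,\alpha_H)$, an $H$-module is a pair $(M,\alpha_M)$ of a $\mathbf{k}$-module and a linear self-map, with a linear structure map $\rho\colon H\otimes M\to M$ such that $\alpha_M\circ\rho=\rho\circ(\alpha_H\otimes\alpha_M)$ and $\rho\circ(\alpha_H\otimes\rho)=\rho\circ(\mu_H\otimes\alpha_M)$. For a Hom-associative algebra $(A,\mu_A,\alpha_A)$, an $H$-module Hom-algebra structure on $A$ is an $H$-module structure $\rho\colon H\otimes A\to A$ on $(A,\alpha_A)$, written $\rho(x,a)=xa$, such that $\alpha_H^2(x)(ab)=\sum_{(x)}(x_1a)(x_2b)$ for all $x\in H$ and $a,b\in A$, where $ab=\mu_A(a,b)$ and $\Delta_H(x)=\sum_{(x)}x_1\otimes x_2$. (When applied to $H_\gamma$ and $A_\beta$, all structure maps in these axioms are those of $H_\gamma$ and $A_\beta$.) *)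

(* Defs.v *)
From HB Require Import structures.
From mathcomp Require Import all_boot all_algebra.
From mathcomp Require Import generic_quotient ring_quotient.
From mathcomp.classical Require Import boolp.
From mathcomp.multinomials Require Import freeg.

Set Implicit Arguments.
Unset Strict Implicit.
Unset Printing Implicit Defensive.

Import GRing.Theory.
Local Open Scope ring_scope.
Local Open Scope quotient_scope.

(* The tensor product of two modules over R: the quotient of the free module
   {freeg (U * V) / R} by the submodule generated by the bilinearity
   relations. *)
Section TensorProduct.
Variables (R : comNzRingType) (U V : lmodType R).
Local Notation F := {freeg (U * V)%type / R}.

Inductive tens_rel : F -> Prop :=
| TensRelDl u u' v : tens_rel (<<(u + u', v)>> - (<<(u, v)>> + <<(u', v)>>))
| TensRelDr u v v' : tens_rel (<<(u, v + v')>> - (<<(u, v)>> + <<(u, v')>>))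
| TensRelZl a u v : tens_rel (<<(a *: u, v)>> - a *: <<(u, v)>>)
| TensRelZr a u v : tens_rel (<<(u, a *: v)>> - a *: <<(u, v)>>)
| TensRel0 : tens_rel 0
| TensRelP a x y : tens_rel x -> tens_rel y -> tens_rel (a *: x + y).

Definition tens_null : F -> bool := fun x => `[< tens_rel x >].

Fact tens_null_zmod_closed : zmod_closed tens_null.
Proof.
split=> [|x y]; first exact/asboolP/TensRel0.
move=> /asboolP hx /asboolP hy; apply/asboolP.
by rewrite addrC -scaleN1r; exact: TensRelP.
Qed.
HB.instance Definition _ := GRing.isZmodClosed.Build F tens_null
  tens_null_zmod_closed.

Definition tens := @Quotient.quot F (GRing.ZmodClosed.clone F tens_null _).
HB.instance Definition _ := GRing.Zmodule.on tens.
HB.instance Definition _ := Quotient.on tens.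

Lemma tens_eqP (x y : F) : reflect (\pi_tens x = \pi_tens y) (`[< tens_rel (x - y) >]).
Proof.
apply: (iffP idP) => [h|/eqP h]; first by apply/eqP; rewrite -Quotient.idealrBE.
by move: h; rewrite -Quotient.idealrBE.
Qed.

Lemma pi_tensD (x y : F) : \pi_tens (x + y) = \pi_tens x + \pi_tens y.
Proof. exact: Quotient.pi_add. Qed.

Lemma pi_tens0 : \pi_tens (0 : F) = 0.
Proof. by apply: (addrI (\pi_tens 0)); rewrite -pi_tensD !addr0. Qed.

Definition tens_scale (a : R) (t : tens) : tens := \pi_tens (a *: repr t).

Lemma pi_tensZ a (x : F) : tens_scale a (\pi_tens x) = \pi_tens (a *: x).
Proof.
apply/tens_eqP/asboolP; rewrite -scalerBr -[_ *: _]addr0.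
apply: TensRelP; last exact: TensRel0.
by apply/asboolP/tens_eqP; rewrite reprK.
Qed.

Fact tens_scaleA a b t : tens_scale a (tens_scale b t) = tens_scale (a * b) t.
Proof.
by elim/quotW: t => x; rewrite (pi_tensZ b) (pi_tensZ a) pi_tensZ scalerA.
Qed.
Fact tens_scale1 : left_id 1 tens_scale.
Proof. by elim/quotW=> x; rewrite pi_tensZ scale1r. Qed.
Fact tens_scaleDr : right_distributive tens_scale +%R.
Proof.
move=> a; elim/quotW=> x; elim/quotW=> y.
by rewrite -pi_tensD !pi_tensZ scalerDr pi_tensD.
Qed.
Fact tens_scaleDl t : {morph tens_scale^~ t : a b / a + b}.
Proof. by elim/quotW: t => x a b; rewrite !pi_tensZ scalerDl pi_tensD. Qed.

HB.instance Definition _ := GRing.Zmodule_isLmodule.Build R tens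
  tens_scaleA tens_scale1 tens_scaleDr tens_scaleDl.

Lemma pi_tens_linear : linear (\pi_tens : F -> tens).
Proof. by move=> a x y; rewrite pi_tensD -pi_tensZ. Qed.

Definition ptens (u : U) (v : V) : tens := \pi_tens <<(u, v)>>.

Fact ptens_bilinear : bilinear_for *:%R *:%R ptens.
Proof.
have Dl u u' v : ptens (u + u') v = ptens u v + ptens u' v.
  by rewrite -pi_tensD; apply/tens_eqP/asboolP/TensRelDl.
have Dr u v v' : ptens u (v + v') = ptens u v + ptens u v'.
  by rewrite -pi_tensD; apply/tens_eqP/asboolP/TensRelDr.
have Zl a u v : ptens (a *: u) v = a *: ptens u v.
  by rewrite [RHS]pi_tensZ; apply/tens_eqP/asboolP/TensRelZl.
have Zr a u v : ptens u (a *: v) = a *: ptens u v.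
  by rewrite [RHS]pi_tensZ; apply/tens_eqP/asboolP/TensRelZr.
by split=> [v a u u'|u a v v']; rewrite ?(Dl, Dr) ?(Zl, Zr).
Qed.
HB.instance Definition _ := bilinear_isBilinear.Build R U V tens _ _ ptens
  ptens_bilinear.

Lemma tens_pureP (t : tens) : exists s : seq (U * V),
  t = \sum_(p <- s) ptens p.1 p.2.
Proof.
elim/quotW: t => x; rewrite -[x]freeg_sumE.
elim: (dom x) => [|p s [s' IHs]].
  by exists [::]; rewrite !big_nil pi_tens0.
exists ((coeff p x *: p.1, p.2) :: s'); rewrite !big_cons pi_tensD IHs.
congr (_ + _) => /=; rewrite (linearZl_LR ptens) [RHS]pi_tensZ.
congr (\pi_tens _); case: p => u v /=.
by apply/eqP/freeg_eqP=> q; rewrite coeffZ !coeffU mul1r.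
Qed.

(* The linear extension of a bilinear f, sum_i (u_i (x) v_i) |-> sum_i f u_i v_i;
   it is only meaningful if f is bilinear. *)
Definition tlift (W : lmodType R) (f : U -> V -> W) (t : tens) : W :=
  fglift (fun p : U * V => f p.1 p.2) (repr t).

Section Lift.
Variables (W : lmodType R) (f : U -> V -> W).
Hypothesis f_bilin : bilinear_for *:%R *:%R f.
Local Notation g := (fglift (fun p : U * V => f p.1 p.2)).

Let gB : {morph g : x y / x - y}. Proof. exact: lift_is_additive. Qed.
Let g0 : g 0 = 0. Proof. by rewrite -[X in g X](subrr 0) gB subrr. Qed.
Let gN : {morph g : x / - x}.
Proof. by move=> x; rewrite -sub0r gB g0 sub0r. Qed.
Let gD : {morph g : x y / x + y}.
Proof. by move=> x y; rewrite -[y in LHS]opprK gB gN opprK. Qed.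
Let gU u v : g <<(u, v)>> = f u v. Proof. by rewrite liftU scale1r. Qed.
Let gZ a x : g (a *: x) = a *: g x.
Proof.
rewrite -[x]freeg_sumE scaler_sumr.
elim: (dom x) => [|p s IHs]; first by rewrite !big_nil g0 scaler0.
rewrite !big_cons !gD scalerDr {}IHs; congr (_ + _).
have -> : a *: << coeff p x *g p >> = << a * coeff p x *g p >>.
  by apply/eqP/freeg_eqP=> q; rewrite coeffZ !coeffU mulrA.
by rewrite !liftU scalerA.
Qed.
Let fDl u u' v : f (u + u') v = f u v + f u' v.
Proof. by have := f_bilin.1 v 1 u u'; rewrite /= !scale1r. Qed.
Let fDr u v v' : f u (v + v') = f u v + f u v'.
Proof. by have := f_bilin.2 u 1 v v'; rewrite /= !scale1r. Qed.
Let f0l v : f 0 v = 0.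
Proof. by apply: (addrI (f 0 v)); rewrite -fDl !addr0. Qed.
Let f0r u : f u 0 = 0.
Proof. by apply: (addrI (f u 0)); rewrite -fDr !addr0. Qed.
Let fZl a u v : f (a *: u) v = a *: f u v.
Proof. by have := f_bilin.1 v a u 0; rewrite /= f0l !addr0. Qed.
Let fZr a u v : f u (a *: v) = a *: f u v.
Proof. by have := f_bilin.2 u a v 0; rewrite /= f0r !addr0. Qed.

Let g_rel x : tens_rel x -> g x = 0.
Proof.
elim=> {x} [u u' v|u v v'|a u v|a u v||a x y _ IHx _ IHy];
  rewrite ?(gB, gD, gZ) ?gU ?(fDl, fDr, fZl, fZr) ?subrr //.
by rewrite IHx IHy scaler0 addr0.
Qed.

Let tlift_pi x : tlift f (\pi_tens x) = g x.
Proof.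
apply/eqP; rewrite -subr_eq0 -gB; apply/eqP/g_rel.
by apply/asboolP/tens_eqP; rewrite reprK.
Qed.

Lemma tlift_ptens u v : tlift f (ptens u v) = f u v.
Proof. by rewrite tlift_pi gU. Qed.

Lemma tlift_linear : linear (tlift f).
Proof.
move=> a; elim/quotW=> x; elim/quotW=> y; rewrite -pi_tens_linear !tlift_pi.
by rewrite gD gZ.
Qed.

Lemma tlift_sum (I : Type) (r : seq I) (x : I -> U) (y : I -> V) :
  tlift f (\sum_(i <- r) ptens (x i) (y i)) = \sum_(i <- r) f (x i) (y i).
Proof.
have l0 : tlift f 0 = 0 by have /= := tlift_linear (-1) 0 0;
  rewrite !scaleN1r oppr0 addr0 addNr.
elim: r => [|i r IHr]; first by rewrite !big_nil.
rewrite !big_cons -[ptens _ _]scale1r tlift_linear scale1r IHr.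
by rewrite tlift_ptens.
Qed.

End Lift.
End TensorProduct.

Notation "U ⊗ V" := (tens U V) (at level 35, right associativity).
Notation "u ⊗ₜ v" := (ptens u v) (at level 35, right associativity) : ring_scope.

Section TensorMaps.
Variable R : comNzRingType.
Implicit Types U V W X : lmodType R.

Lemma tens_ext U V W (f g : {linear U ⊗ V -> W}) :
  (forall u v, f (u ⊗ₜ v) = g (u ⊗ₜ v)) -> f =1 g.
Proof.
move=> fg t; have [s ->] := tens_pureP t.
by rewrite !linear_sum; apply: eq_bigr => p _; exact: fg.
Qed.

Section Map.
Variables (U U' V V' : lmodType R) (f : {linear U -> U'}) (g : {linear V -> V'}).

Definition tmap : U ⊗ V -> U' ⊗ V' := tlift (fun u v => f u ⊗ₜ g v).

Fact tmap_bilinear : bilinear_for *:%R *:%R (fun u v => f u ⊗ₜ g v).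
Proof.
by split=> [v a u u'|u a v v']; rewrite linearP ?(linearPl, linearPr).
Qed.
HB.instance Definition _ := GRing.isLinear.Build R (U ⊗ V) (U' ⊗ V') _ tmap
  (tlift_linear tmap_bilinear).

Lemma tmapE u v : tmap (u ⊗ₜ v) = f u ⊗ₜ g v.
Proof. exact: tlift_ptens tmap_bilinear u v. Qed.
End Map.

Section Swap.
Variables U V : lmodType R.

Definition tswap : U ⊗ V -> V ⊗ U := tlift (fun u v => v ⊗ₜ u).

Fact tswap_bilinear : bilinear_for *:%R *:%R (fun (u : U) (v : V) => v ⊗ₜ u).
Proof. by split=> [v a u u'|u a v v']; rewrite ?(linearPl, linearPr). Qed.
HB.instance Definition _ := GRing.isLinear.Build R (U ⊗ V) (V ⊗ U) _ tswap
  (tlift_linear tswap_bilinear).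

Lemma tswapE u v : tswap (u ⊗ₜ v) = v ⊗ₜ u.
Proof. exact: tlift_ptens tswap_bilinear u v. Qed.
End Swap.

Section Assoc.
Variables U V W : lmodType R.

Definition tassoc : (U ⊗ V) ⊗ W -> U ⊗ V ⊗ W :=
  tlift (fun t w => tlift (fun u v => u ⊗ₜ v ⊗ₜ w) t).

Definition tassoc_inv : U ⊗ V ⊗ W -> (U ⊗ V) ⊗ W :=
  tlift (fun u t => tlift (fun v w => (u ⊗ₜ v) ⊗ₜ w) t).

Let tassoc1_bilinear w :
  bilinear_for *:%R *:%R (fun (u : U) (v : V) => u ⊗ₜ v ⊗ₜ (w : W)).
Proof.
by split=> [v a u u'|u a v v']; rewrite ?(linearPl, linearPr) //.
Qed.
Let tassoc_inv1_bilinear u :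
  bilinear_for *:%R *:%R (fun (v : V) (w : W) => ((u : U) ⊗ₜ v) ⊗ₜ w).
Proof.
by split=> [w a v v'|v a w w']; rewrite ?(linearPl, linearPr) //.
Qed.

Fact tassoc_bilinear : bilinear_for *:%R *:%R
  (fun (t : U ⊗ V) (w : W) => tlift (fun u v => u ⊗ₜ v ⊗ₜ w) t).
Proof.
split=> [w|t a w w']; first exact: tlift_linear (tassoc1_bilinear w).
have [s ->] := tens_pureP t; rewrite !tlift_sum //= scaler_sumr -big_split.
by apply: eq_bigr => p _; rewrite !linearPr.
Qed.
Fact tassoc_inv_bilinear : bilinear_for *:%R *:%R
  (fun (u : U) (t : V ⊗ W) => tlift (fun v w => (u ⊗ₜ v) ⊗ₜ w) t).
Proof.
split=> [t a u u'|u]; last exact: tlift_linear (tassoc_inv1_bilinear u).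
have [s ->] := tens_pureP t; rewrite !tlift_sum //= scaler_sumr -big_split.
by apply: eq_bigr => p _; rewrite !linearPl.
Qed.
HB.instance Definition _ := GRing.isLinear.Build R ((U ⊗ V) ⊗ W) (U ⊗ V ⊗ W) _
  tassoc (tlift_linear tassoc_bilinear).
HB.instance Definition _ := GRing.isLinear.Build R (U ⊗ V ⊗ W) ((U ⊗ V) ⊗ W) _
  tassoc_inv (tlift_linear tassoc_inv_bilinear).

Lemma tassocE u v w : tassoc ((u ⊗ₜ v) ⊗ₜ w) = u ⊗ₜ v ⊗ₜ w.
Proof.
rewrite /tassoc (tlift_ptens tassoc_bilinear).
by rewrite (tlift_ptens (tassoc1_bilinear w)).
Qed.
Lemma tassoc_invE u v w : tassoc_inv (u ⊗ₜ v ⊗ₜ w) = (u ⊗ₜ v) ⊗ₜ w.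
Proof.
rewrite /tassoc_inv (tlift_ptens tassoc_inv_bilinear).
by rewrite (tlift_ptens (tassoc_inv1_bilinear u)).
Qed.
End Assoc.

(* Id (x) tau (x) Id, up to the associativity isomorphisms. *)
Definition tmid U V W X : (U ⊗ V) ⊗ (W ⊗ X) -> (U ⊗ W) ⊗ (V ⊗ X) :=
  @tassoc_inv U W (V ⊗ X)
  \o tmap idfun (@tassoc W V X \o tmap (@tswap V W) idfun \o @tassoc_inv V W X)
  \o @tassoc U V (W ⊗ X).

HB.instance Definition _ U V W X := GRing.Linear.copy (@tmid U V W X)
  (@tassoc_inv U W (V ⊗ X)
  \o tmap idfun (@tassoc W V X \o tmap (@tswap V W) idfun \o @tassoc_inv V W X)
  \o @tassoc U V (W ⊗ X)).

Lemma tmidE U V W X (u : U) (v : V) (w : W) (x : X) :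
  tmid ((u ⊗ₜ v) ⊗ₜ (w ⊗ₜ x)) = (u ⊗ₜ w) ⊗ₜ (v ⊗ₜ x).
Proof.
rewrite /tmid /= tassocE tmapE /= tassoc_invE tmapE /= tswapE tassocE.
by rewrite tassoc_invE.
Qed.

Fact iter_linear U n (f : {linear U -> U}) : linear (iter n f).
Proof. by elim: n => [//|n IHn] a x y; rewrite !iterS IHn linearP. Qed.
HB.instance Definition _ U n (f : {linear U -> U}) :=
  GRing.isLinear.Build R U U _ (iter n f) (iter_linear n f).

End TensorMaps.

(* All algebras are nonunital and all coalgebras noncounital. *)
Section HomStructures.
Variable R : comNzRingType.
Implicit Types A C H M : lmodType R.

Definition hom_assoc_algebra A (mu : {linear A ⊗ A -> A})
    (alpha : {linear A -> A}) : Prop :=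
  alpha \o mu =1 mu \o tmap alpha alpha
  /\ mu \o tmap alpha mu \o @tassoc R A A A =1 mu \o tmap mu alpha.

Definition hom_coassoc_coalgebra C (Delta : {linear C -> C ⊗ C})
    (alpha : {linear C -> C}) : Prop :=
  tmap alpha alpha \o Delta =1 Delta \o alpha
  /\ tmap alpha Delta \o Delta =1 @tassoc R C C C \o tmap Delta alpha \o Delta.

Definition hom_bialgebra H (mu : {linear H ⊗ H -> H})
    (Delta : {linear H -> H ⊗ H}) (alpha : {linear H -> H}) : Prop :=
  [/\ hom_assoc_algebra mu alpha,
      hom_coassoc_coalgebra Delta alpha
    & Delta \o mu =1 tmap mu mu \o @tmid R H H H H \o tmap Delta Delta].

Definition assoc_algebra A (mu : {linear A ⊗ A -> A}) : Prop :=
  hom_assoc_algebra mu idfun.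

Definition bialgebra H (mu : {linear H ⊗ H -> H})
    (Delta : {linear H -> H ⊗ H}) : Prop :=
  hom_bialgebra mu Delta idfun.

Definition algebra_morphism A (mu : {linear A ⊗ A -> A})
    (f : {linear A -> A}) : Prop :=
  f \o mu =1 mu \o tmap f f.

Definition bialgebra_morphism H (mu : {linear H ⊗ H -> H})
    (Delta : {linear H -> H ⊗ H}) (f : {linear H -> H}) : Prop :=
  f \o mu =1 mu \o tmap f f /\ Delta \o f =1 tmap f f \o Delta.

Definition is_module H (mu : {linear H ⊗ H -> H}) M
    (rho : {linear H ⊗ M -> M}) : Prop :=
  forall x y m, rho (x ⊗ₜ rho (y ⊗ₜ m)) = rho (mu (x ⊗ₜ y) ⊗ₜ m).

(* sum_(x) (x_1 a)(x_2 b) *)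
Definition sweedler_act H (Delta : {linear H -> H ⊗ H}) A
    (mu : {linear A ⊗ A -> A}) (rho : {linear H ⊗ A -> A})
    (x : H) (a b : A) : A :=
  tlift (fun x1 x2 => mu (rho (x1 ⊗ₜ a) ⊗ₜ rho (x2 ⊗ₜ b))) (Delta x).

Lemma sweedler_actE H (Delta : {linear H -> H ⊗ H}) A
    (mu : {linear A ⊗ A -> A}) (rho : {linear H ⊗ A -> A}) x a b
    (I : Type) (r : seq I) (x1 x2 : I -> H) :
  Delta x = \sum_(i <- r) x1 i ⊗ₜ x2 i ->
  sweedler_act Delta mu rho x a b
    = \sum_(i <- r) mu (rho (x1 i ⊗ₜ a) ⊗ₜ rho (x2 i ⊗ₜ b)).
Proof.
rewrite /sweedler_act => ->; apply: tlift_sum.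
by split=> [y c z z'|y c z z']; rewrite ?(linearPl, linearPr) linearP
  ?(linearPl, linearPr) linearP.
Qed.

Definition module_algebra H (muH : {linear H ⊗ H -> H})
    (DeltaH : {linear H -> H ⊗ H}) A (muA : {linear A ⊗ A -> A})
    (rho : {linear H ⊗ A -> A}) : Prop :=
  is_module muH rho
  /\ forall x a b, rho (x ⊗ₜ muA (a ⊗ₜ b)) = sweedler_act DeltaH muA rho x a b.

Definition hom_module H (muH : {linear H ⊗ H -> H}) (alphaH : {linear H -> H})
    M (alphaM : {linear M -> M}) (rho : {linear H ⊗ M -> M}) : Prop :=
  alphaM \o rho =1 rho \o tmap alphaH alphaM
  /\ rho \o tmap alphaH rho \o @tassoc R H H M =1 rho \o tmap muH alphaM.

Definition module_hom_algebra H (muH : {linear H ⊗ H -> H})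
    (DeltaH : {linear H -> H ⊗ H}) (alphaH : {linear H -> H})
    A (muA : {linear A ⊗ A -> A}) (alphaA : {linear A -> A})
    (rho : {linear H ⊗ A -> A}) : Prop :=
  hom_module muH alphaH alphaA rho
  /\ forall x a b, rho (iter 2 alphaH x ⊗ₜ muA (a ⊗ₜ b))
                     = sweedler_act DeltaH muA rho x a b.

End HomStructures.

(* Main.v *)
Require Import Defs.
From HB Require Import structures.
From mathcomp Require Import all_boot all_algebra.

Set Implicit Arguments.
Unset Strict Implicit.
Unset Printing Implicit Defensive.

Import GRing.Theory.
Local Open Scope ring_scope.

(** The theorem splits into two independent constructions.

    Pullback: restricting the action of a bialgebra along a bialgebra
    endomorphism delta turns a module algebra into a module algebra over the
    same bialgebra ([module_algebra_pullback]).  With delta the n-th power of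
    alphaH this replaces rho by rho_n := rho o (alphaH^n (x) Id).  As alphaH^n
    commutes with gamma, rho_n still intertwines gamma (x) beta with beta.

    Twisting: if beta and gamma are endomorphisms of the whole structure, one
    obtains the Hom-version by composing every multiplication and action with
    beta or gamma after it, and the comultiplication with gamma before it
    ([assoc_algebra_twist], [bialgebra_twist], [module_algebra_twist]).
    Since the endomorphisms commute with all the structure maps, they can be
    moved to the outside of both sides of an axiom; each side is then the
    square of the endomorphism applied to the corresponding untwisted axiom.
    In the Hom-module-algebra axiom, gamma^2 x acts on beta (a b).  One gamma
    is absorbed with the inner beta by the intertwining relation; the other one
    is the gamma of the twisted comultiplication in the sum over (x).

    The theorem is the twist of rho_n by beta = alphaA^(2^k) and
    gamma = alphaH^(2^k).  As the two exponents agree, iterating the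
    hypothesis on alphaA and alphaH gives beta o rho = rho o (gamma (x) beta)
    ([module_intertwine_iter]). *)

(** * Functoriality of the tensor product *)

Section TensorFunctor.
Variable R : comNzRingType.
Implicit Types U V W X Y : lmodType R.

Lemma eq_tmap U U' V V' (f f' : {linear U -> U'}) (g g' : {linear V -> V'}) :
  f =1 f' -> g =1 g' -> tmap f g =1 tmap f' g'.
Proof. by move=> ff' gg'; apply: tens_ext => u v; rewrite /= !tmapE ff' gg'. Qed.

Lemma tmap_comp U U' U'' V V' V'' (f : {linear U' -> U''}) (f' : {linear U -> U'})
    (g : {linear V' -> V''}) (g' : {linear V -> V'}) :
  tmap (f \o f') (g \o g') =1 tmap f g \o tmap f' g'.
Proof. by apply: tens_ext => u v; rewrite /= !tmapE. Qed.

(** The tensor in the first slot is a sum of pure ones, so agreement on triples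
    of vectors suffices. *)
Lemma tens_ext_l U V W X (f g : {linear (U ⊗ V) ⊗ W -> X}) :
  (forall u v w, f ((u ⊗ₜ v) ⊗ₜ w) = g ((u ⊗ₜ v) ⊗ₜ w)) -> f =1 g.
Proof.
move=> fg; apply: tens_ext => t w; have [s ->] := tens_pureP t.
by rewrite linear_sumlz !linear_sum; apply: eq_bigr => p _; apply: fg.
Qed.

Lemma tens_ext_lr U V W X Y (f g : {linear (U ⊗ V) ⊗ (W ⊗ X) -> Y}) :
  (forall u v w x, f ((u ⊗ₜ v) ⊗ₜ (w ⊗ₜ x)) = g ((u ⊗ₜ v) ⊗ₜ (w ⊗ₜ x))) ->
  f =1 g.
Proof.
move=> fg; apply: tens_ext_l => u v t; have [s ->] := tens_pureP t.
by rewrite linear_sumr !linear_sum; apply: eq_bigr => p _; apply: fg.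
Qed.

Lemma tassoc_natural U U' V V' W W' (f : {linear U -> U'})
    (g : {linear V -> V'}) (h : {linear W -> W'}) :
  tmap f (tmap g h) \o @tassoc R U V W =1 @tassoc R U' V' W' \o tmap (tmap f g) h.
Proof. by apply: tens_ext_l => u v w; rewrite /= tassocE !tmapE /= !tmapE tassocE. Qed.

Lemma tmid_natural U U' V V' W W' X X' (f : {linear U -> U'})
    (g : {linear V -> V'}) (h : {linear W -> W'}) (l : {linear X -> X'}) :
  tmap (tmap f h) (tmap g l) \o @tmid R U V W X
    =1 @tmid R U' V' W' X' \o tmap (tmap f g) (tmap h l).
Proof. by apply: tens_ext_lr => u v w x; rewrite /= tmidE !tmapE /= !tmapE tmidE. Qed.

(** Reduces statements on the iterates of a pair of maps to an induction on a
    single iterate of [tmap f g]. *)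
Lemma tmap_iter U V n (f : {linear U -> U}) (g : {linear V -> V}) :
  tmap (iter n f) (iter n g) =1 iter n (tmap f g).
Proof. by apply: tens_ext => u v; rewrite /= tmapE; elim: n => //= n <-; rewrite tmapE. Qed.

End TensorFunctor.

(** * Iterates of morphisms *)

Section Twist.
Variable R : comNzRingType.
Implicit Types A C H M : lmodType R.

Lemma algebra_morphismE A (mu : {linear A ⊗ A -> A}) (f : {linear A -> A}) :
  algebra_morphism mu f -> forall a b, f (mu (a ⊗ₜ b)) = mu (f a ⊗ₜ f b).
Proof. by move=> fM a b; have /= := fM (a ⊗ₜ b); rewrite tmapE. Qed.

Lemma algebra_morphism_iter A (mu : {linear A ⊗ A -> A}) (f : {linear A -> A}) n :
  algebra_morphism mu f -> algebra_morphism mu (iter n f).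
Proof.
move=> fM t /=; rewrite tmap_iter.
by elim: n t => [|n IHn] t //=; rewrite IHn; apply: fM.
Qed.

Lemma bialgebra_morphism_iter H (mu : {linear H ⊗ H -> H})
    (Delta : {linear H -> H ⊗ H}) (f : {linear H -> H}) n :
  bialgebra_morphism mu Delta f -> bialgebra_morphism mu Delta (iter n f).
Proof.
move=> [fM fD]; split=> [|x]; first exact: algebra_morphism_iter.
by rewrite /= tmap_iter; elim: n => [|n IHn] //=; rewrite -IHn; apply: fD.
Qed.

Lemma module_intertwine_iter H M (rho : {linear H ⊗ M -> M})
    (f : {linear H -> H}) (g : {linear M -> M}) n :
  g \o rho =1 rho \o tmap f g ->
  iter n g \o rho =1 rho \o tmap (iter n f) (iter n g).
Proof.
move=> fg t /=; rewrite tmap_iter.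
by elim: n t => [|n IHn] t //=; rewrite IHn; apply: fg.
Qed.

(** * Twisting by an endomorphism *)

(** Yau twist: both sides of Hom-associativity become beta^2 of the two
    bracketings of a b c. *)
Lemma assoc_algebra_twist A (mu : {linear A ⊗ A -> A}) (beta : {linear A -> A}) :
  assoc_algebra mu -> algebra_morphism mu beta ->
  hom_assoc_algebra (beta \o mu) beta.
Proof.
move=> [_ muA] betaM; have muE := algebra_morphismE betaM.
split; first by apply: tens_ext => a b; rewrite /= tmapE /= muE.
apply: tens_ext_l => a b c; rewrite /= tassocE !tmapE /= -!muE.
by congr (beta (beta _)); have /= := muA ((a ⊗ₜ b) ⊗ₜ c); rewrite tassocE !tmapE.
Qed.

(** Dual to the algebra case: the two copies of gamma move past Delta, so both
    sides are (gamma^2)^(x)3 applied to the iterated coproduct of x. *)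
Lemma coassoc_coalgebra_twist C (Delta : {linear C -> C ⊗ C})
    (gamma : {linear C -> C}) :
  hom_coassoc_coalgebra Delta idfun ->
  Delta \o gamma =1 tmap gamma gamma \o Delta ->
  hom_coassoc_coalgebra (Delta \o gamma) gamma.
Proof.
move=> [_ DeltaA] gammaD; split=> x; first exact/esym/gammaD.
have gD y : Delta (gamma y) = tmap gamma gamma (Delta y) := gammaD y.
have gDg y : Delta (gamma (gamma y)) =
    tmap (gamma \o gamma) (gamma \o gamma) (Delta y).
  by rewrite !gD -[LHS]tmap_comp.
have DA : tmap idfun Delta (Delta x) = tassoc (tmap Delta idfun (Delta x)).
  exact: DeltaA.
rewrite /= !gD -![tmap _ _ (tmap _ _ _)]tmap_comp.
(* Coassociativity of Delta applies once all copies of gamma are outside. *)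
transitivity (tmap (gamma \o gamma) (tmap (gamma \o gamma) (gamma \o gamma))
  (tmap idfun Delta (Delta x))).
  by rewrite -[RHS]tmap_comp; apply: eq_tmap => // y; apply: gDg.
rewrite DA [LHS]tassoc_natural /=; congr (tassoc _).
by rewrite -[LHS]tmap_comp; apply: eq_tmap => // y; apply/esym/gDg.
Qed.

(** In the compatibility axiom both sides equal (gamma^2 (x) gamma^2) of
    Delta (x y): on the right one gamma comes out of the products and the other
    one out of the coproducts, through the middle exchange by naturality. *)
Lemma bialgebra_twist H (mu : {linear H ⊗ H -> H})
    (Delta : {linear H -> H ⊗ H}) (gamma : {linear H -> H}) :
  bialgebra mu Delta -> bialgebra_morphism mu Delta gamma ->
  hom_bialgebra (gamma \o mu) (Delta \o gamma) gamma.
Proof.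
move=> [muA DeltaA Dmu] [gammaM gammaD]; split.
- exact: assoc_algebra_twist.
- exact: coassoc_coalgebra_twist.
move=> t /=; have gD y : Delta (gamma y) = tmap gamma gamma (Delta y) := gammaD y.
have Dmut : Delta (mu t) = tmap mu mu (tmid (tmap Delta Delta t)) := Dmu t.
rewrite !gD Dmut.
(* The middle term has one gamma on the products and one on the four tensor
   factors in front of them. *)
transitivity (tmap (gamma \o mu) (gamma \o mu)
  (tmid (tmap (tmap gamma gamma) (tmap gamma gamma) (tmap Delta Delta t)))).
  have /= <- := tmid_natural gamma gamma gamma gamma (tmap Delta Delta t).
  rewrite -[RHS]tmap_comp -2![LHS]tmap_comp.
  by apply: eq_tmap => u /=; rewrite -[mu (tmap _ _ _)]gammaM.
by rewrite -[tmap _ _ (tmap Delta _ _)]tmap_comp; congr (tmap _ _ (tmid _));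
  apply: eq_tmap => y; apply/esym/gD.
Qed.

(** * Module algebras *)

(** A decomposition of Delta x is sent by delta (x) delta to one of
    Delta (delta x), so the Sweedler sum for delta x is the one for x with the
    action of delta on both legs. *)
Lemma module_algebra_pullback H (muH : {linear H ⊗ H -> H})
    (DeltaH : {linear H -> H ⊗ H}) A (muA : {linear A ⊗ A -> A})
    (rho : {linear H ⊗ A -> A}) (delta : {linear H -> H}) :
  module_algebra muH DeltaH muA rho -> bialgebra_morphism muH DeltaH delta ->
  module_algebra muH DeltaH muA (rho \o tmap delta idfun).
Proof.
move=> [rhoM rhoD] [deltaM deltaD]; split=> [x y m|x a b] /=.
  by rewrite !tmapE /= rhoM (algebra_morphismE deltaM).
rewrite tmapE /= rhoD; have [s Dx] := tens_pureP (DeltaH x).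
rewrite (sweedler_actE _ _ _ _ Dx).
have Ddx : DeltaH (delta x) = \sum_(p <- s) delta p.1 ⊗ₜ delta p.2.
  rewrite [LHS]deltaD /= Dx linear_sum.
  by apply: eq_bigr => p _; rewrite /= tmapE.
rewrite (sweedler_actE _ _ _ _ Ddx).
by apply: eq_bigr => p _; rewrite /= !tmapE.
Qed.

(** The power 2 of the twisting map in the
    Hom-module-algebra axiom is what makes the gammas on the left match the
    beta from the intertwining relation and the gamma inside the twisted
    coproduct. *)
Lemma module_algebra_twist H (muH : {linear H ⊗ H -> H})
    (DeltaH : {linear H -> H ⊗ H}) A (muA : {linear A ⊗ A -> A})
    (rho : {linear H ⊗ A -> A}) (gamma : {linear H -> H})
    (beta : {linear A -> A}) :
  module_algebra muH DeltaH muA rho -> algebra_morphism muA beta ->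
  beta \o rho =1 rho \o tmap gamma beta ->
  module_hom_algebra (gamma \o muH) (DeltaH \o gamma) gamma
    (beta \o muA) beta (beta \o rho).
Proof.
move=> [rhoM rhoD] betaM beta_rho.
have rhoE x a : rho (gamma x ⊗ₜ beta a) = beta (rho (x ⊗ₜ a)).
  by have /= := beta_rho (x ⊗ₜ a); rewrite tmapE => ->.
split=> [|x a b].
  split; first by apply: tens_ext => x a; rewrite /= tmapE -rhoE.
  by apply: tens_ext_l => x y a; rewrite /= tassocE !tmapE /= !rhoE rhoM.
(* The twisted coproduct of x is DeltaH (gamma x): both Sweedler sums run over
   the same decomposition. *)
have [s Dx] := tens_pureP (DeltaH (gamma x)).
rewrite [RHS](sweedler_actE _ _ _ _ (x1 := fst) (x2 := snd) Dx) /=.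
rewrite rhoE rhoD (sweedler_actE _ _ _ _ Dx) !linear_sum.
by apply: eq_bigr => p _; rewrite /= -(algebra_morphismE betaM).
Qed.

End Twist.

Theorem theorem5p6 (R : comNzRingType)
  (charR0 : forall m : nat, m%:R = 0 :> R -> m = 0%N)
  (H A : lmodType R)
  (muH : {linear H ⊗ H -> H}) (DeltaH : {linear H -> H ⊗ H})
  (muA : {linear A ⊗ A -> A}) (rho : {linear H ⊗ A -> A})
  (alphaH : {linear H -> H}) (alphaA : {linear A -> A})
  (bialgH : bialgebra muH DeltaH)
  (assocA : assoc_algebra muA)
  (modA : module_algebra muH DeltaH muA rho)
  (morphH : bialgebra_morphism muH DeltaH alphaH)
  (morphA : algebra_morphism muA alphaA)
  (alpha_rho : alphaA \o rho =1 rho \o tmap alphaH alphaA)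
  (n k : nat) :
  let beta : {linear A -> A} := iter (2 ^ k) alphaA in
  let gamma : {linear H -> H} := iter (2 ^ k) alphaH in
  let rho_nk : {linear H ⊗ A -> A} :=
    iter (2 ^ k) alphaA \o rho \o tmap (iter n alphaH) idfun in
  [/\ hom_assoc_algebra (beta \o muA) beta,
      hom_bialgebra (gamma \o muH) (DeltaH \o gamma) gamma
    & module_hom_algebra (gamma \o muH) (DeltaH \o gamma) gamma
        (beta \o muA) beta rho_nk].
Proof.
move=> beta gamma rho_nk.
have betaM : algebra_morphism muA beta by apply: algebra_morphism_iter.
have gammaM : bialgebra_morphism muH DeltaH gamma.
  exact: bialgebra_morphism_iter.
split; [exact: assoc_algebra_twist | exact: bialgebra_twist |].
pose rho_n : {linear H ⊗ A -> A} := rho \o tmap (iter n alphaH) idfun.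
have modA_n : module_algebra muH DeltaH muA rho_n.
  by apply: module_algebra_pullback => //; apply: bialgebra_morphism_iter.
(* What remains is that beta intertwines rho_n, since alphaH^n and gamma are
   powers of the same map. *)
apply: (module_algebra_twist modA_n betaM).
apply: tens_ext => x a; rewrite /= !tmapE /=.
have /= -> := module_intertwine_iter (2 ^ k) alpha_rho (iter n alphaH x ⊗ₜ a).
by rewrite tmapE /= -!iterD addnC.
Qed.
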